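(* The following conditions are equivalent for a compact a-space $(X,\zeta)$. (1) $X$ is arithmetically normal. (2) There exist a set $I$ and a compact subset $K\subseteq\mathbb{R}^I$ such that $(X,\zeta)$ and $(K,\operatorname{den})$ are isomorphic a-spaces. (3) There exist a set $I$ and a closed subset $K\subseteq[0,1]^I$ such that $(X,\zeta)$ and $(K,\operatorname{den})$ are isomorphic a-spaces.
   Context: $\mathbb{N}=\{0,1,2,\dots\}$ is ordered by divisibility ($0$ is the top element, $1$ the bottom); $\operatorname{lcm}$ of a possibly infinite subset of $\mathbb{N}$ is its supremum in this order (so it is $0$ if there is no positive common multiple). $\mathbb{N}$ carries the upper topology of the divisibility order: the sets $\{m\in\mathbb{N}\mid m \text{ divides } n\}$, $n\in\mathbb{N}$, form a subbasis for the closed sets. An a-space $(X,\zeta)$ is a topological space $X$ with a continuous function $\zeta\colon X\to\mathbb{N}$. An a-map $f\colon (X,\zeta)\to(X',\zeta')$ is a continuous map such that $\zeta'(f(x))$ divides $\zeta(x)$ for all $x\in X$; an isomorphism of a-spaces is a bijective a-map whose inverse is an a-map. A compact a-space is an a-space whose underlying space is compact (Hausdorffness not assumed). For $p/q\in\mathbb{Q}$ with $p\in\mathbb{Z}$, $q\geq 1$ coprime, $\operatorname{den}(p/q)=q$; for $r\in\mathbb{R}\setminus\mathbb{Q}$, $\operatorname{den}(r)=0$. For a set $I$ and $p=(p_i)_{i\in I}\in\mathbb{R}^I$, $\operatorname{den}(p)=\operatorname{lcm}\{\operatorname{den}(p_i)\mid i\in I\}$. $\mathbb{R}^I$ has the product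 topology, and $(K,\operatorname{den})$, for $K\subseteq\mathbb{R}^I$, is the a-space $K$ with the subspace topology and the restriction of $\operatorname{den}$. An arithmetically normal space is an a-space $(X,\zeta)$ with $X$ compact and such that for any two distinct points $x,y\in X$ there are disjoint open neighbourhoods $U$ of $x$ and $V$ of $y$ with $\zeta(z)=0$ for every $z\in X\setminus(U\cup V)$. *)

(* Defs.v *)
From HB Require Import structures.
From mathcomp Require Import all_boot all_order all_algebra finmap.
From mathcomp Require Import all_classical all_reals all_analysis.

Set Implicit Arguments.
Unset Strict Implicit.
Unset Printing Implicit Defensive.

Import Order.TTheory GRing.Theory Num.Theory.
Import numFieldNormedType.Exports.

Local Open Scope classical_set_scope.
Local Open Scope ring_scope.

(* The library's alias [natdvd] is [nat] ordered by divisibility; unlike [nat],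
   which is discrete in the library, it gets the upper topology. *)
HB.instance Definition _ := @isSubBaseTopological.Build natdvd
  nat setT (fun n => ~` [set m : natdvd | (m %| n)%N]).

Lemma closed_divisors (n : nat) : closed [set m : natdvd | (m %| n)%N].
Proof.
rewrite -openC; exists [set ~` [set m : natdvd | (m %| n)%N]]; last first.
  by rewrite bigcup_set1.
by move=> _ ->; exact: finI_from1.
Qed.

Lemma upper_continuous (T : topologicalType) (f : T -> natdvd) :
  (forall n : nat, closed [set x | (f x %| n)%N]) -> continuous f.
Proof.
move=> fcl; apply/continuousP => A [D Dfin <-].
rewrite preimage_bigcup; apply: bigcup_open => B /Dfin [F _ <-].
have -> : f @^-1` (\bigcap_(i in [set` F]) ~` [set m : natdvd | (m %| i)%N])
    = \bigcap_(i in [set` F]) ~` [set x | (f x %| i)%N] by [].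
rewrite bigcap_fset; elim/big_ind : _ => [|U V oU oV|i _]; first exact: openT.
  exact: openI.
by rewrite openC.
Qed.

Record aspace := ASpace {
  aspace_sort :> topologicalType;
  zeta : aspace_sort -> natdvd;
  zeta_continuous : continuous zeta }.

Definition compact_aspace (X : aspace) : Prop := compact [set: X].

Definition amap (X Y : aspace) (f : X -> Y) : Prop :=
  continuous f /\ forall x : X, (zeta (f x) %| zeta x)%N.

Definition aspace_isomorphic (X Y : aspace) : Prop :=
  exists (f : X -> Y) (g : Y -> X),
    [/\ cancel f g, cancel g f, amap f & amap g].

Definition arithmetically_normal (X : aspace) : Prop :=
  compact_aspace X /\
  forall x y : X, x <> y ->
    exists U V : set X,
      [/\ open_nbhs x U, open_nbhs y V, U `&` V = set0 &
          forall z : X, ~ (U `|` V) z -> zeta z = 0%N].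

(* Every set has a supremum for divisibility; that of the empty set is 1. *)
Definition lcm_set (A : set natdvd) : natdvd := supremum (1%N : natdvd) A.

(* The default value [0] of [xget] is taken exactly at the irrationals. *)
Definition den_real (R : realType) (r : R) : nat :=
  xget 0%N [set `|denq q|%N | q in [set q : rat | ratr q = r]].

Definition den (R : realType) (I : Type) (p : {ptws I -> R}) : natdvd :=
  lcm_set [set den_real (p i) | i in [set: I]].

Lemma lcm_setP (A : set natdvd) (n : nat) :
  (lcm_set A %| n)%N <-> forall a : nat, A a -> (a %| n)%N.
Proof.
suff [l Hl] : exists l : natdvd, supremums A l.
  have -> : lcm_set A = l.
    rewrite /lcm_set /supremum; case: ifPn => [/eqP A0|_].
      case: Hl => _ /(_ (1%N : natdvd)); rewrite A0 => H.
      by apply/esym/eqP; rewrite -dvdn1; exact: H.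
    by case: xgetP => [x _ Hx|/(_ l)//]; exact: is_subset1_supremums Hx Hl.
  case: Hl => Al lA; split=> [ln a Aa|H]; last exact: lA.
  exact: dvdn_trans (Al a Aa) ln.
have [[m m0 Am]|no] := pselect (exists2 m : nat, (0 < m)%N &
    forall a : nat, A a -> (a %| m)%N); last first.
  exists (0%N : natdvd); split=> [a _|b Ab]; first exact: dvdn0.
  case: b Ab => [//|b] Ab.
  by exfalso; apply: no; exists b.+1 => // a; exact: Ab.
have ex : exists k, (0 < k)%N && `[< forall a : nat, A a -> (a %| k)%N >].
  by exists m; rewrite m0; exact/asboolP.
case: (ex_minnP ex) => k /andP[k0 /asboolP Ak] kmin.
exists (k : natdvd); split=> [a Aa|b Ab]; first exact: Ak.
change (k %| b)%N.
have : (k <= gcdn k b)%N.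
  apply: kmin; rewrite gcdn_gt0 k0; apply/asboolP => a Aa.
  by rewrite dvdn_gcd Ak//=; exact: (Ab a Aa).
move=> kg; apply/gcdn_idPl/eqP.
by rewrite eqn_leq kg dvdn_leq// dvdn_gcdl.
Qed.

Lemma den_real_rat (R : realType) (q : rat) :
  den_real (ratr q : R) = `|denq q|%N.
Proof.
rewrite /den_real; case: xgetP => [y _ [q' /= /fmorph_inj -> //]|].
by move=> /(_ `|denq q|%N) []; exists q.
Qed.

Lemma den_real_irrat (R : realType) (r : R) :
  (forall q : rat, ratr q <> r) -> den_real r = 0%N.
Proof.
by move=> nr; rewrite /den_real; case: xgetP => // y _ [q /= /nr].
Qed.

Lemma den_real_dvd (R : realType) (r : R) (n : nat) : (0 < n)%N ->
  (den_real r %| n)%N <-> n%:R * r \is a Num.int.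
Proof.
move=> n0; split=> [|/intrP[m nrm]].
  have [[q <-]|nr] := pselect (exists q : rat, ratr q = r); last first.
    rewrite den_real_irrat ?dvd0n ?gtn_eqF// => q qr; apply: nr.
    by exists q.
  rewrite den_real_rat => /dvdnP[k nk].
  apply/intrP; exists (k%:Z * numq q).
  have -> : n%:R = ratr n%:~R :> R by rewrite ratr_int.
  rewrite -rmorphM /= nk -(ratr_int R); congr (ratr _).
  rewrite PoszM absz_denq rmorphM /= -mulrA [_ * q]mulrC.
  by rewrite -numqE -intrM.
have nR : n%:R != 0 :> R by rewrite pnatr_eq0 -lt0n.
have nQ : n%:R != 0 :> rat by rewrite pnatr_eq0 -lt0n.
set q : rat := m%:~R / n%:R.
have qr : ratr q = r.
  rewrite /q fmorph_div /= ratr_int ratr_nat -nrm.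
  by rewrite mulrC mulKf.
rewrite -qr den_real_rat.
have Hz : n%:Z * numq q = m * denq q.
  apply/eqP; rewrite -(eqr_int rat) !intrM numqE /q; apply/eqP.
  by rewrite mulrA mulrCA mulfV// mulr1.
have : (denq q %| n%:Z * numq q)%Z by rewrite Hz dvdz_mull.
by rewrite Gauss_dvdzl ?dvdzE// coprimezE coprime_sym coprime_num_den.
Qed.

Lemma closed_int_num (R : realType) : closed [set r : R | r \is a Num.int].
Proof.
rewrite -openC.
have -> : ~` [set r : R | r \is a Num.int] =
    \bigcup_(z in [set: int]) `](z%:~R : R), (z + 1)%:~R[%classic.
  apply/seteqP; split=> [r /= /negP nr|r [z _] /=].
    exists (Num.floor r) => //=; rewrite in_itv /= floorD1_gt andbT.
    by rewrite lt_neqAle floor_le andbT -intrEfloor.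
  rewrite in_itv /= => /andP[zr rz] /intrP[m rm].
  move: zr rz; rewrite rm !ltr_int => zm mz.
  by move: mz; rewrite ltzD1 leNgt zm.
by apply: bigcup_open => z _; exact: interval_open.
Qed.

Lemma closed_den_real (R : realType) (n : nat) :
  closed [set r : R | (den_real r %| n)%N].
Proof.
have [->|n0] := posnP n.
  rewrite (_ : mkset _ = setT); first exact: closedT.
  by apply/seteqP; split=> // r _ /=; exact: dvdn0.
have -> : [set r : R | (den_real r %| n)%N] =
    (fun r => n%:R * r) @^-1` [set r : R | r \is a Num.int].
  by apply/seteqP; split=> r /= /(den_real_dvd _ n0).
apply: preimage_closed; last exact: closed_int_num.
by move=> r _; exact: mulrl_continuous.
Qed.

Lemma eval_continuous (T : topologicalType) (I : Type) (i : I) :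
  continuous (fun p : {ptws I -> T} => p i).
Proof.
move=> p U Ui.
have /cvg_sup/(_ i) : p --> p by exact: cvg_id.
apply.
exact: (@initial_continuous _ T (fun f : I -> T => f i) p).
Qed.

Lemma den_continuous (R : realType) (I : Type) :
  continuous (@den R I).
Proof.
apply: upper_continuous => n.
have -> : [set p : {ptws I -> R} | (den p %| n)%N] =
    \bigcap_(i in [set: I])
      ((fun p : {ptws I -> R} => p i) @^-1` [set r | (den_real r %| n)%N]).
  apply/seteqP; split=> p /=.
    by move=> /lcm_setP H i _; apply: H; exists i.
  by move=> H; apply/lcm_setP => _ [i _ <-]; exact: H.
apply: closed_bigI => i _; apply: preimage_closed; last exact: closed_den_real.
move=> p _; exact: eval_continuous.
Qed.

Lemma den_subspace_continuous (R : realType) (I : Type)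
  (K : set {ptws I -> R}) : continuous (fun x : K => den (set_val x)).
Proof.
move=> x; apply: continuous_comp; last exact: den_continuous.
exact: initial_continuous.
Qed.

(* As a type, [K] carries the library's subspace topology on [set_type K]. *)
Definition den_aspace (R : realType) (I : Type) (K : set {ptws I -> R}) :
  aspace := ASpace (@den_subspace_continuous R I K).

Definition unit_cube (R : realType) (I : Type) : set {ptws I -> R} :=
  [set p | forall i : I, 0 <= p i <= 1].
Arguments unit_cube R I : clear implicits.

(* Main.v *)
Require Import Defs.
From mathcomp Require Import all_boot all_order all_algebra.
From mathcomp Require Import all_classical all_reals all_analysis.

(** Subspaces of powers of the line are arithmetically normal because an
    irrational number [c] strictly between two distinct coordinates [p i] and
    [q i] separates [p] from [q] by the open half-spaces [p i < c] and
    [c < p i]: a point on the wall has an irrational coordinate, hence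
    denominator 0.  This separation pulls back along injective a-maps
    ([normal_of_injective_amap]).

    Conversely, an arithmetically normal compact space has enough a-maps to the
    unit interval: evaluating all of them at once is an embedding into a cube
    under which [den] restricts to [zeta] ([normal_embeds]).  The a-maps come
    from [arithmetic_insertion], an arithmetic form of the Katetov-Tong
    insertion theorem: between rational-valued functions [l <= u], upper and
    lower semicontinuous, whose denominators divide [zeta], there is a
    continuous real function whose denominators divide [zeta].  Its proof is a
    Urysohn construction whose cuts are taken at irrational levels [r k],
    dense in the line.  At each level two disjoint open sets, destined to be
    [f < r k] and [r k < f], are chosen so that [zeta] vanishes off their union.
    The new requirement is that a point [z] with [zeta z = n > 0] must not be
    put strictly between two levels [a < b] when no multiple of [1/n] lies in
    between, since [f z] has to be such a multiple.  As multiples of [1/n] meet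
    the interval as soon as [n] is large, this requirement involves only
    finitely many [n] and so defines a closed set ([closed_gap]); a new level
    can therefore always be added to finitely many old ones by separating two
    disjoint closed sets ([cut_extension]).  Separation of closed sets follows
    from separation of points by compactness ([zero_separated_closed]). *)

Set Implicit Arguments.
Unset Strict Implicit.
Unset Printing Implicit Defensive.

Import Order.TTheory GRing.Theory Num.Theory.
Import numFieldNormedType.Exports.

Local Open Scope ring_scope.
Local Open Scope classical_set_scope.

(** * Separation of closed sets *)

(** A property of sets that passes to subsets and finite unions is inherited by
    a compact set from small neighbourhoods of its points: otherwise the
    complements of the sets with the property would generate a proper filter on
    [K] without cluster point. *)
Lemma compact_ind (T : topologicalType) (P : set T -> Prop) :
    P set0 -> (forall A B, A `<=` B -> P B -> P A) ->
    (forall A B, P A -> P B -> P (A `|` B)) ->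
  forall K, compact K ->
    (forall x, K x -> exists2 N, nbhs x N & P N) -> P K.
Proof.
move=> P0 Psub PU K cK Ploc; apply: contrapT => nPK.
pose F : set_system T := [set S | P (K `\` S)].
have FF : ProperFilter F.
  split; first by rewrite /F /= setD0.
  split; rewrite /F /=.
  - by rewrite setDT.
  - by move=> S S' PS PS'; rewrite /F /= setDE setCI setIUr -!setDE; exact: PU.
  - by move=> S S' SS'; apply: Psub; exact: setDS.
have FK : F K by rewrite /F /= setDv.
have [x [Kx clx]] := cK F FF FK.
have [N Nx PN] := Ploc x Kx.
have FN : F (~` N) by apply: Psub PN; rewrite setDE setCK; exact: subIsetr.
by have [y []] := clx _ _ FN Nx.
Qed.

Definition zero_separated (X : aspace) (A B : set X) := exists U V : set X,
  [/\ open U, open V & U `&` V = set0] /\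
  [/\ A `<=` U, B `<=` V & forall z : X, ~ (U `|` V) z -> zeta z = 0%N].

Lemma zero_separated_sym (X : aspace) (A B : set X) :
  zero_separated A B -> zero_separated B A.
Proof.
move=> [U [V [[oU oV UV] [AU BV z0]]]]; exists V, U; split; split=> //.
  by rewrite setIC.
by move=> z; rewrite setUC; exact: z0.
Qed.

(** Neighbourhoods of [A] are united while those of [B] are intersected, so only
    finitely many points of [A] may be treated, whence compactness. *)
Lemma zero_separated_compact (X : aspace) (A B : set X) : compact A ->
    (forall x, A x -> exists2 N, nbhs x N & zero_separated N B) ->
  zero_separated A B.
Proof.
move=> cA; apply: (@compact_ind X (fun S => zero_separated S B)) => //.
- exists set0, setT; split; split=> //.
  + exact: open0.
  + exact: openT.
  + by rewrite set0I.
  + by move=> z; rewrite set0U => /(_ I).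
- move=> S S' SS' [U [V [h [S'U BV z0]]]]; exists U, V; split=> //; split=> //.
  exact: subset_trans SS' S'U.
- move=> S S' [U [V [[oU oV UV] [SU BV z0]]]].
  move=> [U' [V' [[oU' oV' UV'] [SU' BV' z0']]]].
  exists (U `|` U'), (V `&` V'); split; split.
  + exact: openU.
  + exact: openI.
  + rewrite setIUl [V `&` V']setIC {1}[V' `&` V]setIC setIA UV set0I set0U.
    by rewrite setIA UV' set0I.
  + exact: setUSS.
  + by move=> z Bz; split; [exact: BV|exact: BV'].
  + move=> z nz; have [Vz|nVz] := pselect (V z); last first.
      by apply: z0 => -[Uz|//]; apply: nz; left; left.
    apply: z0' => -[Uz|Vz']; apply: nz; [by left; right|by right].
Qed.

Lemma zero_separated_closed (X : aspace) (A B : set X) :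
  arithmetically_normal X -> closed A -> closed B -> A `&` B = set0 ->
  zero_separated A B.
Proof.
move=> [cX anX] cA cB AB.
have compA := subclosed_compact cA cX (@subsetT _ _).
have compB := subclosed_compact cB cX (@subsetT _ _).
apply: zero_separated_compact => // x Ax.
have [U [V [[oU oV UV] [xU BV z0]]]] : zero_separated [set x] B.
  apply/zero_separated_sym/zero_separated_compact => // y By.
  have xy : x <> y.
    by move=> xy; rewrite -[False]/(set0 x) -AB; split; rewrite // xy.
  have [U [V [[oU Ux] [oV Vy] UV z0]]] := anX x y xy.
  exists V; first exact: open_nbhs_nbhs.
  apply: zero_separated_sym; exists U, V; split; split=> //.
  by move=> _ ->.
exists U; first by apply: open_nbhs_nbhs; split=> //; exact: xU.
by exists U, V; split; split.
Qed.

(** Dependent choice with full memory: if every finite family satisfying the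
    unary constraints [G] and the pairwise constraints [S] extends by one more
    term, then an infinite family exists. *)
Lemma greedy_choice (C : pointedType) (G : nat -> C -> Prop)
    (S : nat -> C -> nat -> C -> Prop) :
    (forall k (h : nat -> C), (forall i, (i < k)%N -> G i (h i)) ->
       (forall i j, (i < j)%N -> (j < k)%N -> S i (h i) j (h j)) ->
     exists c, G k c /\ forall i, (i < k)%N -> S i (h i) k c) ->
  exists h : nat -> C, (forall i, G i (h i)) /\
    forall i j, (i < j)%N -> S i (h i) j (h j).
Proof.
move=> ext.
pose next k (h : nat -> C) :=
  get [set c | G k c /\ forall i, (i < k)%N -> S i (h i) k c].
pose F := fix F k : nat -> C := if k is k'.+1 then
  (fun i => if i == k' then next k' (F k') else F k' i) else fun _ => point.
pose h i := F i.+1 i.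
have Fh k i : (i < k)%N -> F k i = h i.
  elim: k => // k IH; rewrite ltnS leq_eqVlt => /predU1P[->//|ik] /=.
  by rewrite ltn_eqF// IH.
have hP k : G k (h k) /\ forall i, (i < k)%N -> S i (h i) k (h k).
  elim/ltn_ind: k => k IH.
  have [|i j ij jk|c [Gc Sc]] := ext k (F k).
  - by move=> i ik; rewrite Fh//; case: (IH i ik).
  - by rewrite !Fh//; [case: (IH j jk) => _; exact|exact: ltn_trans jk].
  - rewrite {1 3}/h /= eqxx /next.
    case: xgetP => [_ -> [Gk Sk]|/(_ c)]; last by case.
    by split=> // i ik; rewrite -(Fh k)//; exact: Sk.
exists h; split=> [i|i j ij]; first by case: (hP i).
by case: (hP j) => _; exact.
Qed.

(** * Levels, and gaps between multiples of 1/n *)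

(** The translates of the rationals by [pi]. *)
Lemma dense_irrational_sequence (R : realType) : exists r : nat -> R,
  [/\ injective r, forall k q, ratr q <> r k &
      forall a b, a < b -> exists k, a < r k < b].
Proof.
have /card_esym/card_bijP[e [e' eK e'K]] := card_rat.
exists (fun k => pi + ratr (val (e (SigSub (mem_set (I : setT k)))))); split.
- by move=> k j /addrI/fmorph_inj/val_inj/(can_inj eK)/(congr1 val).
- move=> k q /eqP; rewrite -subr_eq -rmorphB => /eqP qpi.
  apply: (@pi_irrationnal R); rewrite -qpi.
  by exists (q - val (e (SigSub (mem_set (I : setT k))))).
- move=> a b ab; have /rat_in_itvoo[q] : a - pi < b - pi by rewrite ltrD2r.
  rewrite in_itv /= ltrBlDl ltrBrDl => aqb.
  exists (val (e' (SigSub (mem_set (I : setT q))))).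
  set j := SigSub _.
  have -> : j = e' (SigSub (mem_set (I : setT q))) by exact: val_inj.
  by rewrite e'K.
Qed.

(** For [n > 0] the reals whose denominator divides [n] are the multiples of
    [1/n]; this form makes monotonicity in [n] immediate.  The value [n = 0] is
    excluded because it leaves the values of a function unconstrained. *)
Definition gap (R : realType) (n : nat) (a b : R) : Prop :=
  (0 < n)%N /\ forall r, a < r < b -> ~ (den_real r %| n)%N.

Lemma gap_dvd (R : realType) (a b : R) (m n : nat) :
  (m %| n)%N -> gap n a b -> gap m a b.
Proof.
move=> mn [n0 gn]; split; first exact: dvdn_gt0 mn.
by move=> r /gn nr rm; apply: nr; exact: dvdn_trans mn.
Qed.

Lemma gap_bounded (R : realType) (a b : R) : a < b ->
  exists N, forall n, gap n a b -> (n < N)%N.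
Proof.
move=> ab; have ba0 : 0 < b - a by rewrite subr_gt0.
exists (Num.bound (b - a)^-1) => n [n0 gn]; rewrite ltnNge; apply/negP => Nn.
have nR : 0 < n%:R :> R by rewrite ltr0n.
have nba : 1 < n%:R * (b - a).
  rewrite -ltr_pdivrMr// div1r (lt_le_trans (archi_boundP _))// ?ler_nat//.
  by rewrite invr_ge0 ltW.
(* the first multiple of 1/n strictly above a *)
apply: (gn ((Num.floor (n%:R * a) + 1)%:~R / n%:R)); last first.
  by apply/den_real_dvd => //; rewrite mulrC divfK ?gt_eqF// intr_int.
rewrite ltr_pdivlMr// ltr_pdivrMr// [a * _]mulrC [b * _]mulrC floorD1_gt/=.
rewrite intrD (le_lt_trans (lerD (floor_le _) (lexx _)))//.
by rewrite -ltrBrDl -mulrBr.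
Qed.

(** Finitely many [n] have the gap, and the gap passes to divisors, so this set
    is a finite union of sets [zeta z %| n]. *)
Lemma closed_gap (R : realType) (X : aspace) (a b : R) : a < b ->
  closed [set z : X | gap (zeta z) a b].
Proof.
move=> /gap_bounded[N gN].
have -> : [set z : X | gap (zeta z) a b] =
    \bigcup_(n in [set n | gap n a b]) [set z : X | (zeta z %| n)%N].
  apply/seteqP; split=> z /=; last first.
    by move=> [n /= gn] /gap_dvd; exact.
  by move=> gz; exists (zeta z : nat) => //=; exact: dvdnn.
apply: closed_bigcup => [|n _].
  by apply: (sub_finite_set _ (finite_II N)) => n /gN.
change (closed (@zeta X @^-1` [set m : natdvd | (m %| n)%N])).
apply: preimage_closed; last exact: closed_divisors.
by move=> z _; exact: zeta_continuous.
Qed.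

Lemma gap_around (R : realType) (r : R) (n : nat) : ~ (den_real r %| n)%N ->
  exists a b, a < r < b /\ gap n a b.
Proof.
move=> nr; have n0 : (0 < n)%N by case: n nr => [|//]; rewrite dvdn0.
have : nbhs r (~` [set r : R | (den_real r %| n)%N]).
  apply: open_nbhs_nbhs; split=> //.
  by rewrite openC; exact: closed_den_real.
move=> /nbhs_ballP[e /= e0 rn]; exists (r - e), (r + e); split.
  by rewrite ltrBlDr !ltrDl e0.
split=> // s res; apply: (rn s).
by rewrite /ball /= distrC ltr_distl.
Qed.

(** Two adjacent gaps merge when their common endpoint is not itself a multiple
    of [1/n]; the irrationality of the levels is used through this. *)
Lemma gap_split (R : realType) (n : nat) (a r b : R) :
  ~ (den_real r %| n)%N -> gap n a r -> gap n r b -> gap n a b.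
Proof.
move=> nr [n0 gar] [_ grb]; split=> // s /andP[as_ sb].
have [sr|rs|->//] := ltgtP s r.
- by apply: gar; rewrite as_ sr.
- by apply: grb; rewrite rs sb.
Qed.

Lemma den_real_irrational_dvd (R : realType) (r : R) (n : nat) :
  (forall q, ratr q <> r) -> (0 < n)%N -> ~ (den_real r %| n)%N.
Proof.
by move=> /den_real_irrat-> n0; rewrite dvd0n; apply/negP; rewrite -lt0n.
Qed.

Lemma gap_rat (R : realType) (q : rat) (n : nat) (a b : R) :
  (`|denq q| %| n)%N -> gap n a b -> a < ratr q -> ratr q < b -> False.
Proof.
move=> dq [_ g] aq qb; apply: (g (ratr q)); first by rewrite aq qb.
by rewrite den_real_rat.
Qed.


(** * Insertion of a-maps *)

(** The pairs [C] and [D] stand for [({f < a}, {a < f})] and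
    [({f < b}, {b < f})] with [a < b]: every point lies above [a] or below [b],
    and lies in between only if a value allowed by [zeta] does. *)
Definition prec (R : realType) (X : aspace) (a : R) (C : set X * set X) (b : R)
    (D : set X * set X) : Prop :=
  (forall z, C.2 z \/ D.1 z) /\
  (forall z, gap (zeta z) a b -> ~ (C.2 z /\ D.1 z)).

(** A candidate for [({f < r}, {r < f})] with [l <= f <= u]. *)
Definition cut (R : realType) (X : aspace) (l u : X -> rat) (r : R)
    (C : set X * set X) : Prop :=
  [/\ open C.1, open C.2, C.1 `&` C.2 = set0 &
      forall z, ~ (C.1 `|` C.2) z -> zeta z = 0%N] /\
  ((forall z, ratr (u z) < r -> C.1 z) /\ (forall z, r < ratr (l z) -> C.2 z)).

(** The new lower set must contain the closed set [A0] (forced by [u]) and all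
    [A i] (forced by old levels), and the new upper set must contain [B0] and
    all [B i].  A point not above an old level [r i] is forced below [r k]
    if [r i < r k], and also if [r k < r i] but the gap between the two levels
    leaves it no room.  The heart of the proof is that the closed sets forced
    below are disjoint from those forced above. *)
Lemma cut_extension (R : realType) (X : aspace) (l u : X -> rat) (r : nat -> R)
    (k : nat) (h : nat -> set X * set X) :
    arithmetically_normal X -> injective r -> (forall k q, ratr q <> r k) ->
    (forall q, closed [set z | u z <= q]) ->
    (forall q, closed [set z | q <= l z]) ->
    (forall z, l z <= u z) ->
    (forall z, `|denq (u z)| %| zeta z)%N ->
    (forall z, `|denq (l z)| %| zeta z)%N ->
    (forall i, (i < k)%N -> cut l u (r i) (h i)) ->
    (forall i j, (i < k)%N -> (j < k)%N -> r i < r j ->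
       prec (r i) (h i) (r j) (h j)) ->
  exists C, cut l u (r k) C /\ forall i, (i < k)%N ->
    (r i < r k -> prec (r i) (h i) (r k) C) /\
    (r k < r i -> prec (r k) C (r i) (h i)).
Proof.
move=> anX rinj rirr cu cl lu du dl cuth prech.
pose A0 : set X := [set z | ratr (u z) < r k].
pose B0 : set X := [set z | r k < ratr (l z)].
pose A i : set X :=
  ~` (h i).2 `&` [set z | r i < r k \/ gap (zeta z) (r k) (r i)].
pose B i : set X :=
  ~` (h i).1 `&` [set z | r k < r i \/ gap (zeta z) (r i) (r k)].
have ltr_neq i : (i < k)%N -> r i < r k \/ r k < r i.
  move=> ik; have [||/rinj ikE] := ltgtP (r i) (r k); [by left|by right|].
  by move: ik; rewrite ikE ltnn.
have cA0 : closed A0.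
  have -> : A0 = \bigcap_(q in [set q | r k < ratr q]) [set z | u z <= q].
    apply/seteqP; split=> z /= uz.
      by move=> q /= /(lt_trans uz); rewrite ltr_rat => /ltW.
    rewrite /A0 /= ltNge le_eqVlt; apply/negP => /predU1P[/esym/rirr//|].
    move=> /rat_in_itvoo[q]; rewrite in_itv /= ltr_rat => /andP[rq].
    by rewrite ltNge uz.
  by apply: closed_bigI => q _; exact: cu.
have cB0 : closed B0.
  have -> : B0 = \bigcap_(q in [set q | ratr q < r k]) [set z | q <= l z].
    apply/seteqP; split=> z /= lz.
      by move=> q /= /lt_trans/(_ lz); rewrite ltr_rat => /ltW.
    rewrite /B0 /= ltNge le_eqVlt; apply/negP => /predU1P[/rirr//|].
    move=> /rat_in_itvoo[q]; rewrite in_itv /= ltr_rat => /andP[+ rq].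
    by rewrite ltNge lz.
  by apply: closed_bigI => q _; exact: cl.
have cA i : (i < k)%N -> closed (A i).
  move=> ik; have [[_ oV _ _] _] := cuth i ik.
  apply: closedI; first exact: open_closedC.
  have [ri|ri] := ltr_neq i ik.
    rewrite (_ : mkset _ = setT); first exact: closedT.
    by apply/seteqP; split=> // z _; left.
  rewrite (_ : mkset _ = [set z : X | gap (zeta z) (r k) (r i)]).
    exact: closed_gap.
  apply/seteqP; split=> z /=; last by right.
  by case=> // /(lt_trans ri); rewrite ltxx.
have cB i : (i < k)%N -> closed (B i).
  move=> ik; have [[oU _ _ _] _] := cuth i ik.
  apply: closedI; first exact: open_closedC.
  have [ri|ri] := ltr_neq i ik; last first.
    rewrite (_ : mkset _ = setT); first exact: closedT.
    by apply/seteqP; split=> // z _; left.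
  rewrite (_ : mkset _ = [set z : X | gap (zeta z) (r i) (r k)]).
    exact: closed_gap.
  apply/seteqP; split=> z /=; last by right.
  by case=> // /(lt_trans ri); rewrite ltxx.
have AB0 z : A0 z -> B0 z -> False.
  rewrite /A0 /B0 /= => uz /(lt_trans uz).
  rewrite ltr_rat => /(le_lt_trans (lu z)).
  by rewrite ltxx.
(* a gap around u z is impossible, as the value u z is allowed at z *)
have A0B j z : (j < k)%N -> A0 z -> B j z -> False.
  move=> jk A0z [/= nU]; have [_ [uU _]] := cuth j jk.
  have ru : r j < ratr (u z).
    rewrite ltNge le_eqVlt; apply/negP => /predU1P[/rirr//|].
    exact: contra_not (uU z) nU.
  case=> [/(lt_trans A0z)/(lt_trans ru)|g]; first by rewrite ltxx.
  exact: (gap_rat (du z) g ru A0z).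
have AB0' i z : (i < k)%N -> A i z -> B0 z -> False.
  move=> ik [/= nV] + B0z; have [_ [_ lV]] := cuth i ik.
  have ru : ratr (l z) < r i.
    rewrite ltNge le_eqVlt; apply/negP => /predU1P[/esym/rirr//|].
    exact: contra_not (lV z) nV.
  case=> [/(lt_trans ru)/(lt_trans B0z)|g]; first by rewrite ltxx.
  exact: (gap_rat (dl z) g B0z ru).
have ABij i j z : (i < k)%N -> (j < k)%N -> A i z -> B j z -> False.
  move=> ik jk [/= nV Ai] [/= nU Bj].
  have [[_ _ dji zi] _] := cuth i ik; have [[_ _ _ zj] _] := cuth j jk.
  have UV m : (m < k)%N -> (0 < zeta z)%N -> ~ (h m).1 z -> (h m).2 z.
    move=> mk z0 nUm; apply: contrapT => nVm.
    have [[_ _ _ zm] _] := cuth m mk.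
    by move: z0; rewrite zm// => -[].
  have [rij|rji|/rinj ijE] := ltgtP (r i) (r j).
  - by have [/(_ z)[]] := prech i j ik jk rij.
    (* z was put between r j and r i although the gaps from r j to r k and
       from r k to r i leave it no value there *)
  - have z0 : (0 < zeta z)%N.
      case: Ai => [rik|[//]]; case: Bj => [rkj|[//]].
      by move: (lt_trans rik (lt_trans rkj rji)); rewrite ltxx.
    have [_ /(_ z)] := prech j i jk ik rji; apply.
      have irrk := den_real_irrational_dvd (rirr k) z0.
      case: Ai => [rik|gi]; case: Bj => [rkj|gj].
      + by move: (lt_trans rik (lt_trans rkj rji)); rewrite ltxx.
      + case: gj => _ gj; split=> // s /andP[js si]; apply: gj.
        by rewrite js (lt_trans si).
      + case: gi => _ gi; split=> // s /andP[js si]; apply: gi.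
        by rewrite si andbT (lt_trans rkj).
      + exact: gap_split irrk gj gi.
    split; first exact: UV.
    by apply: contrapT => nUi; apply: nV; exact: UV.
  - subst j; have z0 : zeta z = 0%N by apply: zi => -[].
    case: Ai => [rik|[]]; last by rewrite z0.
    case: Bj => [rki|[]]; last by rewrite z0.
    by move: (lt_trans rik rki); rewrite ltxx.
have [|||U [V [[oU oV UV] [AU BV z0]]]] := @zero_separated_closed X
    (A0 `|` \bigcup_(i in `I_k) A i) (B0 `|` \bigcup_(i in `I_k) B i) anX.
- by apply: closedU => //; apply: closed_bigcup => //; exact: finite_II.
- by apply: closedU => //; apply: closed_bigcup => //; exact: finite_II.
- rewrite -subset0 => z [[A0z|[i ik Az]] [B0z|[j jk Bz]]].
  + exact: AB0 B0z.
  + exact: (A0B j z).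
  + exact: (AB0' i z).
  + exact: (ABij i j z).
have AiU i z : (i < k)%N -> A i z -> U z.
  by move=> ik Az; apply: AU; right; exists i.
have BiV i z : (i < k)%N -> B i z -> V z.
  by move=> ik Bz; apply: BV; right; exists i.
have disj z : U z -> V z -> False.
  by move=> Uz Vz; rewrite -[False]/(set0 z) -UV.
exists (U, V); split.
  split; split=> //= z ?; first by apply: AU; left.
  by apply: BV; left.
move=> i ik; have [[_ _ UVi _] _] := cuth i ik.
have disji z : (h i).1 z -> (h i).2 z -> False.
  by move=> Uz Vz; rewrite -[False]/(set0 z) -UVi.
split=> ri; split=> z /=.
- have [|nV] := pselect ((h i).2 z); [by left|right].
  by apply: (AiU i) => //; split=> //; left.
- move=> g [Viz Uz].
  have [Uiz|nU] := pselect ((h i).1 z); first exact: disji Viz.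
  by apply: (disj z Uz); apply: (BiV i) => //; split=> //; right.
- have [|nU] := pselect ((h i).1 z); [by right|left].
  by apply: (BiV i) => //; split=> //; left.
- move=> g [Vz Uiz].
  have [Viz|nV] := pselect ((h i).2 z); first exact: disji Viz.
  by apply: (disj z) Vz; apply: (AiU i) => //; split=> //; right.
Qed.

(** The function is [f z = sup {r k | z lies in the upper set at level r k}].
    If [f z] were not allowed by [zeta z], two levels close to [f z] on either
    side would enclose it in a gap, against [prec]. *)
Lemma arithmetic_insertion (R : realType) (X : aspace) (l u : X -> rat)
    (m M : rat) :
    arithmetically_normal X ->
    (forall q, closed [set z | u z <= q]) ->
    (forall q, closed [set z | q <= l z]) ->
    (forall z, m <= l z) -> (forall z, l z <= u z) -> (forall z, u z <= M) ->
    (forall z, `|denq (u z)| %| zeta z)%N ->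
    (forall z, `|denq (l z)| %| zeta z)%N ->
  exists f : X -> R, [/\ continuous f, forall z, (den_real (f z) %| zeta z)%N &
    forall z, ratr (l z) <= f z <= ratr (u z)].
Proof.
move=> anX cu cl ml lu uM du dl.
have [r [rinj rirr rdense]] := dense_irrational_sequence R.
have [|h [cuth Sh]] := @greedy_choice (set X * set X)%type
  (fun k => cut l u (r k))
  (fun i C j D => (r i < r j -> prec (r i) C (r j) D) /\
                  (r j < r i -> prec (r j) D (r i) C)).
  move=> k h cuth Sh; apply: cut_extension => // i j ik jk rij.
  case: (ltngtP i j) => [ij|ji|ijE].
  - by have [+ _] := Sh i j ij jk; exact.
  - by have [_ +] := Sh j i ji ik; exact.
  - by move: rij; rewrite ijE ltxx.
have prech i j : r i < r j -> prec (r i) (h i) (r j) (h j).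
  move=> rij; case: (ltngtP i j) => [ij|ji|ijE].
  - by have [+ _] := Sh i j ij; exact.
  - by have [_ +] := Sh j i ji; exact.
  - by move: rij; rewrite ijE ltxx.
pose E z := [set r k | k in [set k | (h k).2 z]].
pose f z := sup (E z).
have disj k z : (h k).1 z -> (h k).2 z -> False.
  have [[_ _ UV _] _] := cuth k.
  by move=> Uz Vz; rewrite -[False]/(set0 z) -UV.
have ubE k z : (h k).1 z -> ubound (E z) (r k).
  move=> Uk _ [j /= Vj <-]; rewrite leNgt; apply/negP => rkj.
  have [/(_ z)[Vk|Uj] _] := prech _ _ rkj; first exact: disj Vk.
  exact: disj Vj.
have E0 z : E z !=set0.
  have /rdense[k /andP[_ rk]] : ratr m - 1 < ratr m :> R.
    by rewrite ltrBlDr ltrDl.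
  have [_ [_ Vk]] := cuth k; exists (r k), k => //=; apply: Vk.
  by rewrite (lt_le_trans rk)// ler_rat.
have ubdE z : has_ubound (E z).
  have /rdense[k /andP[rk _]] : ratr M < ratr M + 1 :> R by rewrite ltrDl.
  have [_ [Uk _]] := cuth k; exists (r k); apply: ubE; apply: Uk.
  by rewrite (le_lt_trans _ rk)// ler_rat.
have Uf k z : (h k).1 z -> f z <= r k by move=> /ubE; exact: ge_sup.
have Vf k z : (h k).2 z -> r k <= f z.
  by move=> Vk; apply: ub_le_sup => //; exists k.
have fU k z : f z < r k -> (h k).1 z.
  move=> /rdense[j /andP[fj jk]]; have [/(_ z)[Vj|//] _] := prech _ _ jk.
  by move: (Vf _ _ Vj); rewrite leNgt fj.
have fV k z : r k < f z -> (h k).2 z.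
  move=> /rdense[j /andP[kj jf]]; have [/(_ z)[//|Uj] _] := prech _ _ kj.
  by move: (Uf _ _ Uj); rewrite leNgt jf.
exists f; split.
- move=> z; apply/cvgrPdist_lt => e e0.
  have /rdense[i /andP[ei iz]] : f z - e < f z by rewrite ltrBlDr ltrDl.
  have /rdense[j /andP[zj je]] : f z < f z + e by rewrite ltrDl.
  have [[_ oV _ _] _] := cuth i; have [[oU _ _ _] _] := cuth j.
  have : nbhs z ((h i).2 `&` (h j).1).
    apply: open_nbhs_nbhs; split; first exact: openI.
    by split; [exact: fV|exact: fU].
  apply: filterS => w [/Vf iw /Uf wj].
  by rewrite distrC ltr_distl (lt_le_trans ei)//= (le_lt_trans wj).
- move=> z; apply: contrapT => /gap_around[a [b [/andP[az zb] [z0 g]]]].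
  have [i /andP[ai iz]] := rdense _ _ az.
  have [j /andP[zj jb]] := rdense _ _ zb.
  have [_ /(_ z)] := prech i j (lt_trans iz zj); apply.
    split=> // s /andP[is_ sj]; apply: g.
    by rewrite (lt_trans ai)//= (lt_trans sj).
  by split; [exact: fV|exact: fU].
- move=> z; rewrite !leNgt; apply/andP; split; apply/negP => /rdense[k /andP[]].
    move=> fk kl; have [_ [_ /(_ z kl)/Vf]] := cuth k.
    by rewrite leNgt fk.
  move=> uk kf; have [_ [/(_ z uk)/Uf + _]] := cuth k.
  by rewrite leNgt kf.
Qed.

(** * Powers of the line *)

Lemma ptws_continuous (S T : topologicalType) (I : Type)
    (e : S -> {ptws I -> T}) :
  (forall i, continuous (fun x => e x i)) -> continuous e.
Proof.
move=> ec x; apply/cvg_sup => i.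
exact: (@continuous_comp_initial {ptws I -> T} S T (fun p => p i) e (ec i)).
Qed.

Lemma ptws_real_hausdorff (R : realType) (I : Type) :
  hausdorff_space {ptws I -> R}.
Proof. by apply: (@hausdorff_product {classic I}) => _; exact: Rhausdorff. Qed.

Lemma compact_unit_cube (R : realType) (I : Type) : compact (unit_cube R I).
Proof.
exact: (@tychonoff {classic I} (fun=> R) (fun=> `[0%R, 1%R]%classic)
  (fun=> @segment_compact R 0 1)).
Qed.

Lemma compact_image_val (S : topologicalType) (A : set S) (K : set A) :
  compact A -> closed K -> compact (set_val @` K).
Proof.
move=> cA cK; have [W oW WK] : open (~` K) by rewrite openC.
have -> : set_val @` K = A `&` ~` W.
  apply/seteqP; split=> [_ [y Ky <-]|x [Ax nWx]].
    split; first exact: set_valP.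
    by move=> Wy; have : (~` K) y by rewrite -WK.
  exists (SigSub (mem_set Ax)) => //; apply: contrapT => nK.
  by apply: nWx; have : (~` K) (SigSub (mem_set Ax)) by []; rewrite -WK.
by apply: compact_closedI => //; exact: open_closedC.
Qed.

(** An irrational level between two coordinates separates their points. *)
Lemma normal_of_injective_amap (R : realType) (I : Type) (X : aspace)
    (K : set {ptws I -> R}) (f : X -> den_aspace K) :
  compact_aspace X -> injective f -> amap f -> arithmetically_normal X.
Proof.
move=> cX finj [fc fd]; split=> // x y xy.
pose h z : {ptws I -> R} := set_val (f z).
have hc : continuous h.
  move=> z; apply: continuous_comp; first exact: fc.
  exact: initial_continuous.
have [i hi] : exists i, h x i <> h y i.
  apply: contrapT => nhi; apply/xy/finj/val_inj/funext => i.
  by apply: contrapT => hi; apply: nhi; exists i.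
have [r [_ rirr rdense]] := dense_irrational_sequence R.
have hic : continuous (fun z => h z i).
  move=> z; apply: (@continuous_comp _ _ _ h (fun p => p i)).
  - exact: hc.
  - exact: (@Defs.eval_continuous R I i (h z)).
have hicP := (continuousP _).1 hic.
have oU k : open [set z | h z i < r k].
  exact: (hicP [set s : R | s < r k] (@open_lt _ (r k))).
have oV k : open [set z | r k < h z i].
  exact: (hicP [set s : R | r k < s] (@open_gt _ (r k))).
have h0 k z : ~ h z i < r k -> ~ r k < h z i -> zeta z = 0%N.
  move=> /negP; rewrite -leNgt => kz /negP; rewrite -leNgt => zk.
  have hk : h z i = r k by apply/le_anti/andP.
  apply/eqP; rewrite -dvd0n; apply: dvdn_trans (fd z).
  have -> : 0%N = den_real (h z i) by rewrite hk (den_real_irrat (rirr k)).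
  by have /lcm_setP := dvdnn (den (h z)); apply; exists i.
case: (ltgtP (h x i) (h y i)) => // /rdense[k /andP[xk ky]].
- exists [set z | h z i < r k], [set z | r k < h z i]; split.
  + by split; first exact: oU.
  + by split; first exact: oV.
  + by rewrite -subset0 => z [/= /lt_trans zk /zk]; rewrite ltxx.
  + by move=> z n; apply: (h0 k) => ?; apply: n; [left|right].
- exists [set z | r k < h z i], [set z | h z i < r k]; split.
  + by split; first exact: oV.
  + by split; first exact: oU.
  + by rewrite -subset0 => z [/= /[swap] /lt_trans zk /zk]; rewrite ltxx.
  + by move=> z n; apply: (h0 k) => ?; apply: n; [right|left].
Qed.
(** * Embedding arithmetically normal spaces into cubes *)

Lemma normal_closed_set1 (X : aspace) (x : X) :
  arithmetically_normal X -> closed [set x].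
Proof.
move=> [_ anX]; apply/accessible_closed_set1/hausdorff_accessible.
rewrite open_hausdorff => a b /eqP/anX[U [V [[oU Ua] [oV Vb] UV _]]].
by exists (U, V); split; rewrite ?inE ?UV.
Qed.

Lemma denq_natV (m : nat) : (0 < m)%N -> `|denq (m%:R^-1)|%N = m.
Proof. by move=> m0; rewrite (@denqVz m) ?abszE ?eqz_nat -?lt0n. Qed.

(** Insertion between the lower function equal to [1/m] at [x] and 0 elsewhere,
    and the upper function equal to [1/m] at [x], 0 on [C] and 1 elsewhere. *)
Lemma arithmetic_bump (R : realType) (X : aspace) (x : X) (C : set X)
    (m : nat) :
    arithmetically_normal X -> closed C -> ~ C x ->
    (0 < m)%N -> (m %| zeta x)%N ->
  exists f : X -> R, [/\ continuous f, forall z, (den_real (f z) %| zeta z)%N,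
    forall z, 0 <= f z <= 1, f x = m%:R^-1 & forall z, C z -> f z = 0].
Proof.
move=> anX cC nCx m0 mx.
have m1 : m%:R^-1 <= 1 :> rat by rewrite invf_le1 ?ltr0n// ler1n.
have m0' : 0 <= m%:R^-1 :> rat by rewrite invr_ge0 ler0n.
pose l z : rat := if z == x then m%:R^-1 else 0.
pose u z : rat := if z == x then m%:R^-1 else if z \in C then 0 else 1.
have lu z : l z <= u z.
  by rewrite /l /u; case: ifP => // _; case: ifP.
have u1 z : u z <= 1.
  by rewrite /u; case: ifP => // _; case: ifP.
have l0 z : 0 <= l z by rewrite /l; case: ifP.
have denm : (`|denq (m%:R^-1)| %| m)%N by rewrite denq_natV.
have cst (P : bool) : closed [set _ : X | P].
  case: P; rewrite ?set_true ?set_false; [exact: closedT|exact: closed0].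
have cx := @normal_closed_set1 X x anX.
have [|||||||f [fc fd lfu]] := @arithmetic_insertion R X l u 0 1 anX => //.
- move=> q; have [q1|q1] := leP 1 q.
    rewrite (_ : mkset _ = setT); first exact: closedT.
    by apply/seteqP; split=> // z _ /=; exact: le_trans q1.
  rewrite (_ : mkset _ = [set x] `&` [set _ | m%:R^-1 <= q] `|`
                         C `&` [set _ | 0 <= q]).
    by apply: closedU; apply: closedI.
  apply/seteqP; split=> z /=; rewrite /u.
    case: eqP => [->|_]; first by left.
    case: ifPn => [|_]; first by rewrite inE; right.
    by rewrite leNgt q1.
  move=> [[-> mq]|[Cz q0]]; first by rewrite eqxx.
  by rewrite ifN ?mem_set//; apply/eqP => zx; apply: nCx; rewrite -zx.
- move=> q; have [q0|q0] := leP q 0.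
    rewrite (_ : mkset _ = setT); first exact: closedT.
    by apply/seteqP; split=> // z _ /=; exact: le_trans (l0 z).
  rewrite (_ : mkset _ = [set x] `&` [set _ | q <= m%:R^-1]).
    exact: closedI.
  apply/seteqP; split=> z /=; rewrite /l.
    by case: eqP => [->//|_]; rewrite leNgt q0.
  by move=> [-> ?]; rewrite eqxx.
- move=> z; rewrite /u; case: eqP => [->|_]; first exact: dvdn_trans mx.
  by case: ifP; rewrite dvd1n.
- move=> z; rewrite /l; case: eqP => [->|_]; first exact: dvdn_trans mx.
  by rewrite dvd1n.
exists f; split=> //.
- move=> z; have /andP[lf fu] := lfu z.
  rewrite (le_trans _ lf) ?(le_trans fu)//.
    by rewrite -(rmorph1 (@ratr R)) ler_rat.
  by rewrite -(rmorph0 (@ratr R)) ler_rat.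
- have := lfu x; rewrite /l /u eqxx fmorphV /= ratr_nat.
  by move=> h; apply/esym/le_anti; rewrite h.
- move=> z Cz; have zx : (z == x) = false.
    by apply/eqP => zx; apply: nCx; rewrite -zx.
  have := lfu z; rewrite /l /u zx mem_set// rmorph0 => h.
  by apply/esym/le_anti; rewrite h.
Qed.

(** Bumps of height 1 separate points.  A bump of height [1/m] at [x] makes
    [den (e x)] a multiple of [m], for each positive divisor [m] of [zeta x];
    when [zeta x = 0], every [m > 0] is such a divisor, which forces
    [den (e x) = 0]. *)
Lemma normal_embeds (R : realType) (X : aspace) : arithmetically_normal X ->
  exists (I : Type) (e : X -> {ptws I -> R}), [/\ continuous e, injective e,
    forall x i, 0 <= e x i <= 1 & forall x, den (e x) = zeta x].
Proof.
move=> anX.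
pose I := {f : X -> R | [/\ continuous f,
  forall z, (den_real (f z) %| zeta z)%N & forall z, 0 <= f z <= 1]}.
pose e (x : X) : {ptws I -> R} := fun i => sval i x.
exists I, e; split.
- by apply: ptws_continuous => -[f []].
- move=> x y exy; apply: contrapT => xy.
  have [f [fc fd f01 fx fy]] := @arithmetic_bump R X x [set y] 1 anX
    (normal_closed_set1 anX) xy isT (dvd1n _).
  pose i : I := exist _ f (And3 fc fd f01).
  have := congr1 (fun p => p i) exy; rewrite /e /= fx fy//.
  by rewrite invr1 => /eqP; rewrite oner_eq0.
- by move=> x [f [fc fd f01]]; exact: f01.
move=> x; apply/eqP; rewrite eqn_dvd; apply/andP; split.
  by apply/lcm_setP => _ [[f [fc fd f01]] _ <-]; exact: fd.
have den_mul m : (0 < m)%N -> (m %| zeta x)%N -> (m %| den (e x))%N.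
  move=> m0 mx.
  have [f [fc fd f01 fx _]] :=
    @arithmetic_bump R X x set0 m anX (@closed0 _) id m0 mx.
  pose i : I := exist _ f (And3 fc fd f01).
  have -> : m = den_real (e x i).
    have -> : e x i = ratr m%:R^-1 by rewrite /e /= fx fmorphV /= ratr_nat.
    by rewrite den_real_rat denq_natV.
  by have /lcm_setP := dvdnn (den (e x)); apply; exists i.
have [z0|z0] := posnP (zeta x); last by exact: den_mul.
(* a positive den (e x) would be divisible by its successor *)
have [d0|d0] := posnP (den (e x)); first by rewrite d0 dvdn0.
have := den_mul (den (e x)).+1 (ltn0Sn _).
by rewrite z0 dvdn0 => /(_ isT)/(dvdn_leq d0); rewrite ltnn.
Qed.

(** Closed subsets of [X] have compact, hence closed, images in a power of the
    line, so the inverse of [e] is continuous. *)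
Lemma compact_embedding_isomorphic (R : realType) (I : Type) (X : aspace)
    (e : X -> {ptws I -> R}) :
    compact_aspace X -> continuous e -> injective e ->
    (forall x, den (e x) = zeta x) ->
  aspace_isomorphic X (den_aspace (range e)).
Proof.
move=> cX ec einj eden.
pose f x : den_aspace (range e) := SigSub (mem_set (imageT e x)).
have gP (y : den_aspace (range e)) : exists x, e x = set_val y.
  by have [x _ xy] := set_valP y; exists x.
pose g y := sval (cid (gP y)).
have gK : cancel g f by move=> y; apply: val_inj; rewrite /= /g; case: cid.
have fK : cancel f g by move=> x; apply: einj; rewrite /g; case: cid.
exists f, g; split=> //; split.
- exact: continuous_comp_initial.
- by move=> x; rewrite -eden.
- apply/continuous_closedP => A cA.
  have -> : g @^-1` A = set_val @^-1` (e @` A).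
    apply/seteqP; split=> y /=; first by exists (g y) => //; rewrite -{2}[y]gK.
    by move=> [x Ax exy]; rewrite -[y](_ : f x = y) ?fK//; exact: val_inj.
  have /continuous_closedP := @initial_continuous (range e) _ set_val; apply.
  apply: compact_closed; first exact: ptws_real_hausdorff.
  apply: continuous_compact.
    exact: continuous_subspaceT.
  exact: subclosed_compact cA cX (@subsetT _ _).
- by move=> y; rewrite -eden -{2}[y]gK.
Qed.

Theorem theorem6p11 (R : realType) (X : aspace) (hX : compact_aspace X) :
  [<-> arithmetically_normal X;
       exists (I : Type) (K : set {ptws I -> R}),
         compact K /\ aspace_isomorphic X (den_aspace K);
       exists (I : Type) (K : set (unit_cube R I)),
         closed K /\ aspace_isomorphic X (den_aspace (set_val @` K))].
Proof.
have n3 : arithmetically_normal X ->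
    exists (I : Type) (K : set (unit_cube R I)),
      closed K /\ aspace_isomorphic X (den_aspace (set_val @` K)).
  move=> /(normal_embeds R)[I [e [ec einj e01 eden]]].
  exists I, (set_val @^-1` (range e)).
  have -> : set_val @` (set_val @^-1` (range e) : set (unit_cube R I)) =
      range e.
    apply/seteqP; split=> [_ [y ye <-]//|p ep].
    have p01 : unit_cube R I p by case: ep => x _ <-; exact: e01.
    by exists (SigSub (mem_set p01)).
  split; last exact: compact_embedding_isomorphic.
  have /continuous_closedP :=
    @initial_continuous (unit_cube R I) _ set_val; apply.
  apply: compact_closed; first exact: ptws_real_hausdorff.
  by apply: continuous_compact => //; exact: continuous_subspaceT.
have n1 : (exists (I : Type) (K : set {ptws I -> R}),
    compact K /\ aspace_isomorphic X (den_aspace K)) -> arithmetically_normal X.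
  move=> [I [K [_ [f [g [fK _ fa _]]]]]].
  exact: normal_of_injective_amap hX (can_inj fK) fa.
have n2 : (exists (I : Type) (K : set (unit_cube R I)),
      closed K /\ aspace_isomorphic X (den_aspace (set_val @` K))) ->
    exists (I : Type) (K : set {ptws I -> R}),
      compact K /\ aspace_isomorphic X (den_aspace K).
  move=> [I [K [cK iso]]]; exists I, (set_val @` K); split=> //.
  exact: (@compact_image_val {ptws I -> R} _ K (@compact_unit_cube R I) cK).
tfae; last by move=> ?; exact/n1/n2.
- by move=> ?; exact/n2/n3.
- by move=> ?; exact/n3/n1.
Qed.
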